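(* Let $f:2^V\to\mathbb R_{\ge0}$ be a (not necessarily monotone) submodular function, $P_1,\dots,P_k$ a partition of $V$ with budgets $n_1,\dots,n_k$, and $S^*$ a maximizer of $f$ over sets $S$ with $|S\cap P_a|\le n_a$ for all $a$. Run Algorithm 4 with the following parameters. (1) Small budget case, $\min_a n_a\le10$: $p=0.3$; for $n_a\ge11$, $d_a=\frac{1-p}{p}=\frac73$; for $n_a=1,\dots,10$, $d_a$ equals respectively $1,\ 1.7961,\ 2.0654,\ 2.1627,\ 2.2107,\ 2.2387,\ 2.2567,\ 2.2692,\ 2.2783,\ 2.2852$. Then, with $Q_a=\max\{1+c_a+d_a,(1-\frac1{n_a})c_a+\frac1p\}$, one has $\frac{1-p}{Q_a}\ge 0.175,\ 0.18,\ 0.18,\ 0.182,\ 0.183,\ 0.183,\ 0.184,\ 0.185,\ 0.185,\ 0.185$ for $n_a=1,\dots,10$ respectively, and $\frac{1-p}{Q_a}\ge0.1896\left(1-\frac{0.7771}{n_a}\right)$ for $n_a\ge11$. (2) Large budget case, $\min_a n_a\ge11$: let $d=1.9532$ (an approximate solution of $e^d(d-1)-d^2-2d+1=0$), $p=\frac1{d+1}$ and $d_a=d$ for all $a$. Then $\frac{1-p}{Q_a}\ge0.1921\left(1-\frac{0.7676}{n_a}\right)$. In both cases $\mathbb E[f(S)]\ge\min_a\frac{1-p}{Q_a}f(S^* )$; the approximation ratio is at least $0.175$ for all budgets and at least $0.1921\left(1-\frac{0.7676}{\min_a n_a}\right)$ when $\min_a n_a\ge11$.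
   Context: Algorithm 4. The elements of $V$ are labeled $1,\dots,m$ in arbitrary arrival order. Given $p\in(0,1)$ and $d_a>0$, set $c_a=(1+d_a)/\big((1+d_a/n_a)^{n_a}-1\big)$ and $g_a(i)=\frac{c_a}{n_a}(1+d_a/n_a)^{i-1}$ for $i\in[n_a]$. Maintain $S$, initially $\emptyset$, and thresholds $\beta_a=0$. For $t=1,\dots,m$: let $a$ be the index with $t\in P_a$, compute $w_t=f(S\cup\{t\})-f(S)$ (for the current $S$), and draw $Z_t\sim\mathrm{Bernoulli}(p)$ independently of everything else; if $w_t\ge\beta_a$ and $Z_t=1$, then: if $|S\cap P_a|<n_a$ add $t$ to $S$, otherwise remove from $S$ an element $t'\in S\cap P_a$ minimizing $w_{t'}$ and add $t$; then set $\beta_a=\sum_{i=1}^{n_a}w_a(i)g_a(i)$, where $w_a(i)$ is the $i$-th largest value in $\{w_s:s\in S\cap P_a\}$ ($0$ if $i>|S\cap P_a|$). Weights are never recomputed. Otherwise $t$ is discarded. Output the final $S$. *)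

(* Defs.v *)
From HB Require Import structures.
From mathcomp Require Import all_boot all_order all_algebra.
Set Implicit Arguments. Unset Strict Implicit. Unset Printing Implicit Defensive.
Import Order.TTheory GRing.Theory Num.Theory.
Local Open Scope ring_scope.

Section Alg.
Variable R : realFieldType.

Definition submodular (m : nat) (f : {set 'I_m} -> R) : Prop :=
  forall A B : {set 'I_m}, f (A :|: B) + f (A :&: B) <= f A + f B.

Definition block (m k : nat) (part : 'I_m -> 'I_k) (a : 'I_k) : {set 'I_m} :=
  [set t | part t == a].

Definition feasible (m k : nat) (part : 'I_m -> 'I_k) (n : 'I_k -> nat)
  (S : {set 'I_m}) : Prop :=
  forall a, (#|S :&: block part a| <= n a)%N.

Definition cc (d : R) (n : nat) : R := (1 + d) / ((1 + d / n%:R) ^+ n - 1).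
Definition gg (d : R) (n : nat) (i : nat) : R :=
  cc d n / n%:R * (1 + d / n%:R) ^+ i.-1.
Definition QQ (p d : R) (n : nat) : R :=
  Num.max (1 + cc d n + d) ((1 - n%:R^-1) * cc d n + p^-1).

(* i-th largest value (i >= 1) of a multiset of reals, 0 if i > size *)
Definition kth_largest (s : seq R) (i : nat) : R :=
  nth 0 (sort (fun x y => y <= x) s) i.-1.

Definition threshold (d : R) (n : nat) (ws : seq R) : R :=
  \sum_(1 <= i < n.+1) kth_largest ws i * gg d n i.

(* admissible tie-breaking rule for the removed element: a minimizer of
   the stored weights in the (nonempty) set A *)
Definition valid_choice (m : nat)
  (choose : 'I_m -> {set 'I_m} -> ('I_m -> R) -> 'I_m) : Prop :=
  forall t A w, A != set0 ->
    choose t A w \in A /\ (forall s, s \in A -> w (choose t A w) <= w s).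

Definition state (m k : nat) : Type :=
  ({set 'I_m} * ('I_m -> R) * ('I_k -> R))%type.

Definition step (m k : nat) (f : {set 'I_m} -> R) (part : 'I_m -> 'I_k)
  (n : 'I_k -> nat) (d : 'I_k -> R)
  (choose : 'I_m -> {set 'I_m} -> ('I_m -> R) -> 'I_m)
  (Z : {ffun 'I_m -> bool}) (st : state m k) (t : 'I_m) : state m k :=
  let: (SS, w, beta) := st in
  let a := part t in
  let wt := f (t |: SS) - f SS in
  if (beta a <= wt) && Z t then
    let S1 := if (#|SS :&: block part a| < n a)%N then t |: SS
              else t |: (SS :\ choose t (SS :&: block part a) w) in
    let w' := fun s => if s == t then wt else w s in
    let beta' := fun b => if b == a then
                   threshold (d a) (n a) [seq w' s | s <- enum (S1 :&: block part a)]
                 else beta b in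
    (S1, w', beta')
  else (SS, w, beta).

Definition run (m k : nat) (f : {set 'I_m} -> R) (part : 'I_m -> 'I_k)
  (n : 'I_k -> nat) (d : 'I_k -> R)
  (choose : 'I_m -> {set 'I_m} -> ('I_m -> R) -> 'I_m)
  (Z : {ffun 'I_m -> bool}) : {set 'I_m} :=
  (foldl (step f part n d choose Z)
     ((set0, fun _ => 0, fun _ => 0) : state m k) (enum 'I_m)).1.1.

Definition prob_of (m : nat) (p : R) (Z : {ffun 'I_m -> bool}) : R :=
  \prod_(t < m) (if Z t then p else 1 - p).

Definition expected_value (m k : nat) (f : {set 'I_m} -> R)
  (part : 'I_m -> 'I_k) (n : 'I_k -> nat) (p : R) (d : 'I_k -> R)
  (choose : 'I_m -> {set 'I_m} -> ('I_m -> R) -> 'I_m) : R :=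
  \sum_(Z : {ffun 'I_m -> bool}) prob_of p Z * f (run f part n d choose Z).

Definition minf (k : nat) (r : 'I_k -> R) : R :=
  \big[Order.min/head 0 [seq r a | a <- enum 'I_k]]_(a < k) r a.

Definition p_small : R := 3%:R / 10%:R.
Definition d_small (n : nat) : R :=
  match n with
  | 1 => 1
  | 2 => 17961%:R / 10000%:R
  | 3 => 20654%:R / 10000%:R
  | 4 => 21627%:R / 10000%:R
  | 5 => 22107%:R / 10000%:R
  | 6 => 22387%:R / 10000%:R
  | 7 => 22567%:R / 10000%:R
  | 8 => 22692%:R / 10000%:R
  | 9 => 22783%:R / 10000%:R
  | 10 => 22852%:R / 10000%:R
  | _ => (1 - p_small) / p_small
  end.
Definition small_lb (n : nat) : R :=
  match n with
  | 1 => 175%:R / 1000%:R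
  | 2 => 18%:R / 100%:R
  | 3 => 18%:R / 100%:R
  | 4 => 182%:R / 1000%:R
  | 5 => 183%:R / 1000%:R
  | 6 => 183%:R / 1000%:R
  | 7 => 184%:R / 1000%:R
  | 8 => 185%:R / 1000%:R
  | 9 => 185%:R / 1000%:R
  | 10 => 185%:R / 1000%:R
  | _ => 1896%:R / 10000%:R * (1 - 7771%:R / 10000%:R / n%:R)
  end.

Definition d_large : R := 19532%:R / 10000%:R.
Definition p_large : R := 1 / (d_large + 1).

End Alg.

Definition nmin (k : nat) (n : 'I_k -> nat) : nat :=
  \big[minn/head 0%N [seq n a | a <- enum 'I_k]]_(a < k) n a.

(* Main.v *)
(** Let [A_t] be the set of elements accepted up to time [t], let
    [U_t = A_t :|: (Sstar :&: [1..t])], let [rho_a] be [n_a] minus the number of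
    elements of [Sstar] in block [a] seen so far, and let [W_a] be the sum of the
    stored weights of the current solution in block [a].  The expectation of
      [f U_t + \sum_a rho_a * beta_a - \sum_a Q_a * W_a]
    does not increase with [t].  When an element of weight [y] replaces one of
    weight [x], the rearrangement inequality shows that [n_a * beta_a] grows by at
    most [c y + d beta_a - (1 + d + c) x]; together with [beta_a <= y] this yields
    the term [1 + c + d] of [Q_a] for elements outside [Sstar], and the term
    [(1 - 1/n) c + 1/p] for elements of [Sstar], which pay their weight even when
    the coin rejects them.  At the end [f S >= f set0 + \sum_a W_a] by
    submodularity, and the expectation of [f (Sstar :|: A)] is at least
    [(1 - p) f Sstar] because each element is in [A] with probability at most [p].
    For [n >= 11] the ratios are estimated by truncating the binomial expansion of
    [(1 + d/n)^n] after degree 8. *)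
Require Import Defs.
From HB Require Import structures.
From mathcomp Require Import all_boot all_order all_algebra.
From mathcomp Require Import ring lra.
Import Order.TTheory GRing.Theory Num.Theory.
Local Open Scope ring_scope.
Set Implicit Arguments. Unset Strict Implicit. Unset Printing Implicit Defensive.

(** * Weighted sums of sorted sequences and the growth of a threshold *)

Section Weighted.
Variable R : realFieldType.
Implicit Types (g : nat -> R) (s u : seq R) (d x y : R).

Local Notation desc := (fun x y : R => y <= x).

Let desc_trans : transitive desc.
Proof. by move=> y x z yx zy; apply: le_trans zy yx. Qed.

Let desc_anti : antisymmetric desc.
Proof. by move=> x y; rewrite andbC => /le_anti. Qed.

Let desc_total : total desc.
Proof. by move=> x y; apply: le_total. Qed.

(** Shifting the weights along the recursion lets insertion into a sorted sequence be treated by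
    induction. Indices start at 0 here, hence [gg d n i.+1] below. *)
Fixpoint wsum g s : R :=
  if s is v :: s' then v * g 0%N + wsum (fun i => g i.+1) s' else 0.

Lemma wsumE g s n : (size s <= n)%N ->
  \sum_(0 <= i < n) nth 0 s i * g i = wsum g s.
Proof.
elim: n s g => [|n IHn] [|v s] g //= sn.
- by rewrite big_geq.
- by rewrite big1 // => i _; rewrite nth_nil mul0r.
- by rewrite big_nat_recl //= (IHn s (fun i => g i.+1)).
Qed.

Lemma eq_wsum g1 g2 s : g1 =1 g2 -> wsum g1 s = wsum g2 s.
Proof.
by elim: s g1 g2 => //= v s IHs g1 g2 g12; rewrite g12 (IHs _ _ (fun i => g12 i.+1)).
Qed.

Lemma wsumZ a g s : wsum (fun i => a * g i) s = a * wsum g s.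
Proof.
by elim: s g => [|v s IHs] g /=; rewrite ?mulr0 // (IHs (fun i => g i.+1)); ring.
Qed.

Lemma wsum_rcons g s x : wsum g (rcons s x) = wsum g s + x * g (size s).
Proof.
elim: s g => [|v s IHs] g /=; first by rewrite addr0 add0r.
by rewrite (IHs (fun i => g i.+1)) addrA.
Qed.

Lemma wsum_ge_const g s x : (forall i, 0 <= g i) -> all (fun v => x <= v) s ->
  x * \sum_(i < size s) g i <= wsum g s.
Proof.
elim: s g => [|v s IHs] g g0 /=; first by rewrite big_ord0 mulr0.
move=> /andP[xv xs]; rewrite big_ord_recl mulrDr lerD //.
  by rewrite ler_wpM2r.
exact: (IHs (fun i => g i.+1)).
Qed.

Fixpoint insert_desc y s : seq R :=
  if s is v :: s' then if v <= y then y :: s else v :: insert_desc y s'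
  else [:: y].

Lemma perm_insert_desc y s : perm_eq (insert_desc y s) (y :: s).
Proof.
elim: s => //= v s IHs; case: ifP => // _.
rewrite (perm_trans (y := v :: y :: s)) ?perm_cons //.
by rewrite -[v :: y :: s]/([:: v] ++ y :: s) perm_catC /= perm_cons perm_catC.
Qed.

Lemma insert_desc_sorted y s :
  sorted desc s -> sorted desc (insert_desc y s).
Proof.
elim: s => //= v s IHs vs; case: ifPn => [vy|]; first by rewrite /= vy.
rewrite -ltNge => yv.
rewrite /= (path_sortedE desc_trans) (IHs (path_sorted vs)) andbT.
rewrite (perm_all _ (perm_insert_desc y s)) /= (ltW yv) /=.
by move: vs; rewrite (path_sortedE desc_trans) => /andP[].
Qed.

Lemma sort_cons y s : sort desc (y :: s) = insert_desc y (sort desc s).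
Proof.
apply: (sorted_eq desc_trans desc_anti).
- exact: sort_sorted.
- by rewrite insert_desc_sorted // sort_sorted.
rewrite perm_sort perm_sym (perm_trans (perm_insert_desc _ _)) //.
by rewrite perm_cons perm_sort.
Qed.

Lemma sort_cons_min x s : all (fun v => x <= v) s ->
  sort desc (x :: s) = rcons (sort desc s) x.
Proof.
move=> xs; apply: (sorted_eq desc_trans desc_anti).
- exact: sort_sorted.
- rewrite -cats1 (sorted_pairwise desc_trans) pairwise_cat /= andbT.
  rewrite -(sorted_pairwise desc_trans) sort_sorted // andbT.
  by rewrite allrel1r all_sort.
by rewrite perm_sort perm_sym perm_rcons perm_cons perm_sort.
Qed.

(* Rearrangement: against increasing weights, the descending order gives the
   smallest sum, so putting [y] in front can only increase it. *)
Lemma wsum_insert_le g y s : {homo g : i j / (i <= j)%N >-> i <= j} ->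
  wsum g (insert_desc y s) <= wsum g (y :: s).
Proof.
elim: s g => //= v s IHs g g_nd; case: ifPn => //; rewrite -ltNge => yv /=.
have g_nd' : {homo (fun i => g i.+1) : i j / (i <= j)%N >-> i <= j}.
  by move=> i j ij; apply: g_nd.
have /= := IHs _ g_nd'; have := g_nd 0%N 1%N isT.
by nra.
Qed.

Lemma wsum_insert_ge g x y s : (forall i, 0 <= g i) -> sorted desc s ->
  all (fun v => x <= v) s -> x <= y ->
  wsum g (rcons s x) <= wsum g (insert_desc y s).
Proof.
elim: s g y => [|v s IHs] g y g0 s_sorted xs xy /=.
  by rewrite lerD2r ler_wpM2r.
have s'_sorted := path_sorted s_sorted.
case/andP: xs => xv xs; case: ifPn => [vy|_] /=; last first.
  by rewrite lerD2l IHs.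
rewrite lerD ?ler_wpM2r //.
rewrite -/(wsum (fun i => g i.+1) (v :: s)).
(* Once [y] is in front, the tail sees [v] as its newly inserted element. *)
suff <- : insert_desc v s = v :: s by apply: IHs.
by case: s s_sorted {IHs s'_sorted xs} => //= u s /andP[-> _].
Qed.

Lemma cc_gt0 d n : 0 < d -> (0 < n)%N -> 0 < cc d n.
Proof.
move=> d0 n0; rewrite /cc divr_gt0 //; first by rewrite addr_gt0.
by rewrite subr_gt0 exprn_egt1 -?lt0n // ltrDl divr_gt0 // ltr0n.
Qed.

(** One growth factor beyond the last weight gives [1 + d + c], the coefficient of the discarded
    weight in [threshold_update]. *)
Lemma cc_eq d n : 0 < d -> (0 < n)%N ->
  cc d n * (1 + d / n%:R) ^+ n = 1 + d + cc d n.
Proof.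
move=> d0 n0; rewrite /cc.
set q := (1 + d / n%:R) ^+ n.
have q1 : 1 < q by rewrite /q exprn_egt1 -?lt0n // ltrDl divr_gt0 // ltr0n.
by field; lra.
Qed.

Lemma gg_ge0 d n i : 0 < d -> (0 < n)%N -> 0 <= gg d n i.
Proof.
move=> d0 n0; have n0' : 0 < n%:R :> R by rewrite ltr0n.
have c0 := cc_gt0 d0 n0; have q0 : 0 < d / n%:R by rewrite divr_gt0.
apply: mulr_ge0; first by rewrite divr_ge0 ?(ltW c0) ?(ltW n0').
by rewrite exprn_ge0 // addr_ge0 // ltW.
Qed.

Lemma gg_nd d n : 0 < d -> (0 < n)%N ->
  {homo (fun i => gg d n i.+1) : i j / (i <= j)%N >-> i <= j}.
Proof.
move=> d0 n0 i j ij; have n0' : 0 < n%:R :> R by rewrite ltr0n.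
have q1 : 1 <= 1 + d / n%:R by rewrite lerDl divr_ge0 // ltW.
rewrite /gg /= ler_wpM2l ?ler_weXn2l //.
by have c0 := cc_gt0 d0 n0; rewrite divr_ge0 ?(ltW c0) ?(ltW n0').
Qed.

(** Geometric series: a full block of weights equal to [x] has threshold [(1 + d) / d * x]. *)
Lemma sum_gg d n : 0 < d -> (0 < n)%N ->
  d * \sum_(i < n) gg d n i.+1 = 1 + d.
Proof.
move=> d0 n0; have n0' : 0 < n%:R :> R by rewrite ltr0n.
rewrite /gg /= -mulr_sumr.
have := subrX1 (1 + d / n%:R) n; set S := \sum_(i < n) _ => sX.
have := cc_eq d0 n0; rewrite -[X in _ * X](subrK 1) sX => e.
have -> : d * (cc d n / n%:R * S) = cc d n * ((1 + d / n%:R - 1) * S).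
  by field; rewrite ?lt0r_neq0.
by lra.
Qed.

Lemma threshold_wsum d n s : (size s <= n)%N ->
  threshold d n s = wsum (fun i => gg d n i.+1) (sort desc s).
Proof.
move=> sn; rewrite /threshold /kth_largest big_add1 /=.
by rewrite (wsumE (fun i => gg d n i.+1)) // size_sort.
Qed.

Lemma perm_threshold d n s1 s2 : perm_eq s1 s2 ->
  threshold d n s1 = threshold d n s2.
Proof.
move=> s12; rewrite /threshold /kth_largest.
by have /(perm_sortP desc_total desc_trans desc_anti) -> := s12.
Qed.

Lemma threshold_cons0 d n s : (size s < n)%N -> all (fun v => 0 <= v) s ->
  threshold d n (0 :: s) = threshold d n s.
Proof.
move=> sn s0; rewrite !threshold_wsum //; last exact: ltnW.
by rewrite sort_cons_min // wsum_rcons mul0r addr0.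
Qed.

Lemma threshold_ge0 d n s : 0 < d -> (0 < n)%N -> (size s <= n)%N ->
  all (fun v => 0 <= v) s -> 0 <= threshold d n s.
Proof.
move=> d0 n0 sn s0; rewrite threshold_wsum //.
rewrite -(mul0r (\sum_(i < size (sort desc s)) gg d n i.+1)).
by apply: wsum_ge_const; rewrite ?all_sort // => i; apply: gg_ge0.
Qed.

(* A block that is not yet full is covered by [x = 0], see [threshold_cons0]. *)
Lemma threshold_update d n s x y (b := threshold d n (x :: s))
    (b' := threshold d n (y :: s)) :
    0 < d -> (0 < n)%N -> (size s < n)%N -> 0 <= x ->
    all (fun v => x <= v) s -> x = 0 \/ size s = n.-1 -> b <= y ->
  [/\ (1 + d) * x <= d * b, x <= y, b <= b' &
      n%:R * (b' - b) <= cc d n * y + d * b - (1 + d + cc d n) * x].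
Proof.
move=> d0 n0 sn x0 xs x_or by_.
have n0' : 0 < n%:R :> R by rewrite ltr0n.
set g := fun i => gg d n i.+1.
have g0 i : 0 <= g i by apply: gg_ge0.
pose u := sort desc s.
have bE : b = wsum g (rcons u x) by rewrite /b threshold_wsum // sort_cons_min.
have b'E : b' = wsum g (insert_desc y u) by rewrite /b' threshold_wsum // sort_cons.
have b0 : 0 <= b.
  apply: threshold_ge0 => //=; rewrite x0 /=.
  by apply: sub_all xs => v; apply: le_trans.
have lb : (1 + d) * x <= d * b.
  case: x_or => [->|sz]; first by rewrite mulr0 mulr_ge0 // ltW.
  have xs' : all (fun v => x <= v) (rcons u x) by rewrite all_rcons lexx all_sort.
  have := wsum_ge_const g0 xs'; rewrite size_rcons size_sort sz prednK // -bE.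
  rewrite -(sum_gg d0 n0) mulrAC -mulrA => h.
  by apply: ler_wpM2l => //; apply: ltW.
have xy : x <= y by nra.
split=> //.
  by rewrite bE b'E wsum_insert_ge ?sort_sorted ?all_sort.
(* Putting [y] in front moves every other weight by one index, which multiplies its coefficient by
   [1 + d / n]. *)
have := wsum_insert_le y u (gg_nd d0 n0); rewrite -/g -b'E /=.
rewrite (@eq_wsum (fun i => g i.+1) (fun i => (1 + d / n%:R) * g i)); last first.
  by move=> i; rewrite /g /gg /= exprS; ring.
rewrite wsumZ; move: bE; rewrite wsum_rcons size_sort => bE h.
(* A nonzero [x] sits at the last index [n - 1], where [cc_eq] evaluates the shifted coefficient. *)
have xg : n%:R * (1 + d / n%:R) * (x * g (size s)) = (1 + d + cc d n) * x.
  case: x_or => [->|->]; first by rewrite !(mul0r, mulr0).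
  rewrite -(cc_eq d0 n0) /g /gg prednK //=.
  rewrite -[X in _ = _ * _ ^+ X * _](prednK n0) exprS.
  by field; rewrite lt0r_neq0.
have ng : n%:R * g 0%N = cc d n by rewrite /g /gg /= expr0; field; rewrite lt0r_neq0.
have nq : n%:R * (1 + d / n%:R) = n%:R + d by field; rewrite lt0r_neq0.
have : n%:R * b' <= n%:R * (y * g 0%N + (1 + d / n%:R) * wsum g u).
  by rewrite ler_pM2l.
have -> : wsum g u = b - x * g (size s) by rewrite bE addrK.
rewrite mulrDr mulrCA ng mulrA [_ * (b - _)]mulrBr xg nq.
by lra.
Qed.

End Weighted.

(** * Expectation over independent coins *)

Section Expectation.
Variables (R : realFieldType) (m : nat) (p : R).
Implicit Types (X Y : {ffun 'I_m -> bool} -> R) (Z : {ffun 'I_m -> bool}).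

Definition expect X : R := \sum_Z prob_of p Z * X Z.

Lemma expectD X Y : expect (fun Z => X Z + Y Z) = expect X + expect Y.
Proof. by rewrite -big_split; apply: eq_bigr => Z _; rewrite mulrDr. Qed.

Lemma expectZ a X : expect (fun Z => a * X Z) = a * expect X.
Proof. by rewrite mulr_sumr; apply: eq_bigr => Z _; rewrite mulrCA. Qed.

Lemma expect_cst a : expect (fun=> a) = a.
Proof.
rewrite /expect -mulr_suml /prob_of.
rewrite -(bigA_distr_bigA (fun (t : 'I_m) (b : bool) => if b then p else 1 - p)).
by rewrite big1 ?mul1r // => t _; rewrite big_bool /= addrC subrK.
Qed.

Lemma ler_expect X Y : 0 <= p <= 1 -> (forall Z, X Z <= Y Z) ->
  expect X <= expect Y.
Proof.
move=> /andP[p0 p1] XY; apply: ler_sum => Z _; apply: ler_wpM2l => //.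
by apply: prodr_ge0 => t _; case: ifP; rewrite ?subr_ge0.
Qed.

Definition flip (t : 'I_m) Z : {ffun 'I_m -> bool} :=
  [ffun s => (s == t) (+) Z s].

Lemma flipK t : involutive (flip t).
Proof. by move=> Z; apply/ffunP => s; rewrite !ffunE addKb. Qed.

(** Each outcome is paired with the one where coin [t] is toggled. Both share the values of [G b]
    and the probability of the other coins, so this conditions on coin [t]. *)
Lemma expect_coord (t : 'I_m) (G : bool -> {ffun 'I_m -> bool} -> R) :
    (forall b Z, G b (flip t Z) = G b Z) ->
  expect (fun Z => G (Z t) Z) =
  expect (fun Z => p * G true Z + (1 - p) * G false Z).
Proof.
move=> G_indep.
pose rest Z : R := \prod_(s < m | s != t) (if Z s then p else 1 - p).
have restF Z : rest (flip t Z) = rest Z.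
  by apply: eq_bigr => s /negPf st; rewrite ffunE st.
have probE Z : prob_of p Z = (if Z t then p else 1 - p) * rest Z.
  by rewrite /prob_of (bigD1 t).
have splitE X : expect X = \sum_(Z : {ffun 'I_m -> bool} | Z t)
    rest Z * (p * X Z + (1 - p) * X (flip t Z)).
  rewrite /expect (bigID (fun Z : {ffun 'I_m -> bool} => Z t)) /=.
  rewrite [X in _ + X](reindex_inj (inv_inj (flipK t))) /=.
  rewrite [X in _ + X](eq_bigl (fun Z : {ffun 'I_m -> bool} => Z t)); last first.
    by move=> Z; rewrite ffunE eqxx /= negbK.
  rewrite -big_split; apply: eq_bigr => Z Zt.
  by rewrite !probE restF ffunE eqxx Zt /=; ring.
rewrite !splitE; apply: eq_bigr => Z Zt.
by rewrite ffunE eqxx Zt /= !G_indep; congr (_ * _); ring.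
Qed.

Lemma expect_bernoulli (t : 'I_m) : expect (fun Z => (Z t)%:R) = p.
Proof.
rewrite (expect_coord (G := fun b _ => b%:R)) //.
by rewrite mulr1 mulr0 addr0 expect_cst.
Qed.

End Expectation.

(** * Marginals of a submodular function and random sampling *)

Section Submodular.
Variables (R : realFieldType) (m : nat) (f : {set 'I_m} -> R).
Hypothesis f_sub : submodular f.
Implicit Types (A P S X Y : {set 'I_m}) (s : seq 'I_m) (c q : 'I_m -> R).

(** Diminishing returns. The second condition excludes [t] in [Y] but not in [X], where the right
    side may be negative as [f] need not be monotone. *)
Lemma submodular_marginal X Y t : X \subset Y -> (t \in Y -> t \in X) ->
  f (t |: Y) - f Y <= f (t |: X) - f X.
Proof.
move=> XY tYX; have [tY|tY] := boolP (t \in Y).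
  have tX := tYX tY.
  by rewrite !(setUidPr _) ?sub1set // !subrr.
have := f_sub (t |: X) Y; rewrite -setUA (setUidPr XY).
rewrite setIUl (setIidPl XY) (_ : [set t] :&: Y = set0) ?set0U; last first.
  by apply/setP => u; rewrite !inE; case: eqP => // ->; apply: negbTE.
by lra.
Qed.

(** Linear in [c], so expectations pass through; for [c = 1] it telescopes to the gain of adding all
    of [s] to [P]. *)
Fixpoint marginals P s c : R :=
  if s is t :: s' then c t * (f (t |: P) - f P) + marginals (t |: P) s' c else 0.

(** Elements of [A] are added to [X] one by one, while [P] receives every scanned element; marginals
    over the larger set are no larger. *)
Lemma marginals_le A X P s : X \subset P -> uniq s ->
    {in s, forall t, t \in P -> t \in X} ->
  f X + marginals P s (fun t => (t \in A)%:R) <=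
  f (X :|: [set t in s | t \in A]).
Proof.
elim: s X P => [|t s IHs] X P XP /=.
  move=> _ _; rewrite addr0 [X in f (_ :|: X)](_ : _ = set0) ?setU0 //.
move=> /andP[ts us] sPX.
have sP u : u \in s -> u \in t |: P -> u \in X.
  move=> us'; rewrite in_setU1 => /predU1P[ut|uP]; first by rewrite -ut us' in ts.
  by apply: sPX; rewrite // in_cons us' orbT.
have := submodular_marginal XP (sPX t (mem_head _ _)).
have [tA|/negPf tA] := boolP (t \in A) => mX.
  have := IHs (t |: X) (t |: P) (setUS _ XP) us.
  rewrite [X in _ <= f X](_ : _ = X :|: [set u in t :: s | u \in A]); last first.
    by apply/setP => u; rewrite !inE; case: eqP => [->|]; rewrite ?tA ?orbT.
  move=> IH; have := IH (fun u us' uP => setU1r _ (sP u us' uP)).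
  by rewrite mul1r; lra.
have := IHs X (t |: P) (subset_trans XP (subsetUr _ _)) us sP.
rewrite mul0r add0r [X in _ <= f X](_ : _ = X :|: [set u in t :: s | u \in A]) //.
by apply/setP => u; rewrite !inE; case: eqP => [->|]; rewrite ?tA ?andbF.
Qed.

Lemma expect_marginals p P s (C : {ffun 'I_m -> bool} -> 'I_m -> R) :
  expect p (fun Z => marginals P s (C Z)) =
  marginals P s (fun t => expect p (C^~ t)).
Proof.
elim: s P => [|t s IHs] P /=; first by rewrite expect_cst.
rewrite expectD IHs mulrC -expectZ; congr (_ + _).
by apply: eq_bigr => Z _; congr (_ * _); rewrite mulrC.
Qed.

Hypothesis f_ge0 : forall S, 0 <= f S.

(* Abel summation. *)
Lemma marginals_ge b P s q : (forall t, 0 <= q t) ->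
    sorted (fun t u => q u <= q t) s -> {in s, forall t, q t <= b} -> 0 <= b ->
  - (b * f P) <= marginals P s q.
Proof.
move=> q0; elim: s b P => [|t s IHs] b P /= s_sorted sb b0.
  by rewrite oppr_le0 mulr_ge0.
have q_trans : transitive (fun t u : 'I_m => q u <= q t).
  by move=> y x z yx zy; apply: le_trans zy yx.
have st : {in s, forall u, q u <= q t}.
  by move: s_sorted; rewrite (path_sortedE q_trans) => /andP[/allP].
(* With [q t] as bound for the tail, the terms [q t * f (t |: P)] cancel. *)
have IH := IHs (q t) (t |: P) (path_sorted s_sorted) st (q0 t).
have := ler_wpM2r (f_ge0 P) (sb t (mem_head _ _)).
by lra.
Qed.

(** Scanning by decreasing probability [q] of membership makes the expected marginals an Abel sum
    with coefficients at most [p], so at most [p * f S] is lost. *)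
Lemma sampling p S (A : {ffun 'I_m -> bool} -> {set 'I_m}) : 0 <= p <= 1 ->
    (forall Z t, t \in A Z -> Z t) ->
  (1 - p) * f S <= expect p (fun Z => f (S :|: A Z)).
Proof.
move=> p01 AZ; pose q t := expect p (fun Z => (t \in A Z)%:R).
pose s := sort (fun t u => q u <= q t) (enum 'I_m).
have q0 t : 0 <= q t.
  by rewrite -[X in X <= _](expect_cst m p); apply: ler_expect.
have qp t : q t <= p.
  rewrite -[X in _ <= X](expect_bernoulli p t); apply: ler_expect => // Z.
  by have [/AZ ->|_] := boolP (t \in A Z); rewrite ?lexx ?ler0n.
have s_sorted : sorted (fun t u => q u <= q t) s.
  by apply: sort_sorted => t u; apply: le_total.
have le1 Z : f S + marginals S s (fun t => (t \in A Z)%:R) <= f (S :|: A Z).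
  have := @marginals_le (A Z) S S s (subxx _).
  rewrite sort_uniq enum_uniq => /(_ isT) /(_ (fun _ _ => id)) /le_trans-> //.
  rewrite (_ : [set _ in _ | _] = A Z) //.
  by apply/setP => t; rewrite inE mem_sort mem_enum.
have /andP[p0 _] := p01.
apply: le_trans (ler_expect p01 le1).
rewrite expectD expect_cst expect_marginals.
have := marginals_ge S q0 s_sorted (fun t _ => qp t) p0.
by rewrite -/q; lra.
Qed.

End Submodular.

(** * One step of the algorithm: eviction, acceptance and the local inequality *)

Section Run.
Variables (R : realFieldType) (m k : nat) (f : {set 'I_m} -> R).
Variables (part : 'I_m -> 'I_k) (n : 'I_k -> nat) (p : R) (d : 'I_k -> R).
Variable choose : 'I_m -> {set 'I_m} -> ('I_m -> R) -> 'I_m.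
Hypotheses (f_ge0 : forall S, 0 <= f S) (f_sub : submodular f).
Hypotheses (n_gt0 : forall a, (0 < n a)%N) (choose_valid : valid_choice choose).
Hypotheses (p_gt0 : 0 < p) (p_le1 : p <= 1).
Hypotheses (d_gt0 : forall a, 0 < d a) (pd_le1 : forall a, p * d a <= 1).

Local Notation block := (block part).
Local Notation step := (step f part n d choose).

Implicit Types (SS A X : {set 'I_m}) (w : 'I_m -> R) (beta : 'I_k -> R).
Implicit Types (s : seq 'I_m) (t : 'I_m) (Z : {ffun 'I_m -> bool}).

Definition weights w SS a : seq R := [seq w t | t <- enum (SS :&: block a)].
Definition block_weight w SS a : R := \sum_(t in SS :&: block a) w t.

(* [A] collects all the elements ever accepted, [s] all those processed. *)
Record invariant s A SS w beta : Prop := Invariant {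
  inv_sub : SS \subset A;
  inv_proc : {subset A <= s};
  inv_card : forall a, (#|SS :&: block a| <= n a)%N;
  inv_w_ge0 : {in SS, forall t, 0 <= w t};
  inv_beta : forall a, beta a = threshold (d a) (n a) (weights w SS a);
  inv_value : forall X, X \subset SS -> f set0 + \sum_(t in X) w t <= f X }.

Lemma perm_weights_setU1 w SS a t : t \notin SS -> part t = a ->
  perm_eq (weights w (t |: SS) a) (w t :: weights w SS a).
Proof.
move=> tS ta; rewrite -[_ :: _]/(map w (t :: enum (SS :&: block a))).
apply/perm_map/uniq_perm; first exact: enum_uniq.
  by rewrite /= enum_uniq mem_enum !inE (negPf tS).
move=> u; rewrite inE !mem_enum !inE.
by case: eqP => [->|]; rewrite ?ta ?eqxx.
Qed.

Lemma size_weights w SS a : size (weights w SS a) = #|SS :&: block a|.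
Proof. by rewrite size_map -cardE. Qed.

Lemma eq_weights w1 w2 SS a : {in SS, w1 =1 w2} ->
  weights w1 SS a = weights w2 SS a.
Proof. by move=> w12; apply/eq_in_map => t; rewrite mem_enum inE => /andP[/w12]. Qed.

Lemma block_weight_setU1 w SS a t : t \notin SS -> part t = a ->
  block_weight w (t |: SS) a = w t + block_weight w SS a.
Proof.
move=> tS ta; rewrite /block_weight.
rewrite (_ : _ :&: _ = t |: (SS :&: block a)); last first.
  by apply/setP => u; rewrite !inE; case: eqP => // ->; rewrite ta eqxx.
by rewrite big_setU1 // inE (negPf tS).
Qed.

Lemma beta_ge0 s A SS w beta a : invariant s A SS w beta -> 0 <= beta a.
Proof.
move=> I; rewrite (inv_beta I) threshold_ge0 ?size_weights ?(inv_card I) //.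
by apply/allP => v /mapP[t]; rewrite mem_enum inE => /andP[/(inv_w_ge0 I) ? _] ->.
Qed.

(* [K] is what is kept of the solution before [t] is added, and [x] the weight
   of the discarded element, [0] if nothing is discarded. *)
Lemma evict s A SS w beta t (a := part t) : invariant s A SS w beta ->
  let K := if (#|SS :&: block a| < n a)%N then SS
           else SS :\ choose t (SS :&: block a) w in
  exists x, let ws := weights w K a in
  [/\ K \subset SS /\ (forall b, b != a -> K :&: block b = SS :&: block b),
      0 <= x /\ all (fun v => x <= v) ws,
      (size ws < n a)%N /\ (x = 0 \/ size ws = (n a).-1),
      beta a = threshold (d a) (n a) (x :: ws) &
      block_weight w SS a = x + block_weight w K a].
Proof.
move=> I K; rewrite {}/K; case: ifPn => [lt_n|].
  exists 0; have w0 : all (fun v => 0 <= v) (weights w SS a).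
    by apply/allP => v /mapP[u]; rewrite mem_enum inE => /andP[/(inv_w_ge0 I) ? _] ->.
  split=> //; rewrite ?size_weights ?add0r //; first by split=> //; left.
  by rewrite threshold_cons0 ?size_weights // (inv_beta I).
rewrite -leqNgt => ge_n.
have card_n : #|SS :&: block a| = n a by apply/anti_leq; rewrite (inv_card I).
have /(choose_valid t w) : SS :&: block a != set0.
  by rewrite -card_gt0 card_n.
set e := choose _ _ _ => -[]; rewrite !inE => /andP[eS /eqP ea] e_min.
have eK : e \notin SS :\ e by rewrite !inE eqxx.
have size_ws : size (weights w (SS :\ e) a) = (n a).-1.
  have := perm_size (perm_weights_setU1 w eK ea).
  by rewrite setD1K //= !size_weights card_n => ->.
exists (w e); split.
- split; first exact: subD1set.
  move=> b ba; apply/setP => u; rewrite !inE; case: eqP => //= ->.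
  by rewrite ea eq_sym (negPf ba) andbF.
- split; first exact: inv_w_ge0 I e eS.
  apply/allP => v /mapP[u]; rewrite mem_enum !inE -andbA => /and3P[_ uS ua] ->.
  by rewrite e_min // !inE uS.
- by rewrite size_ws prednK //; split=> //; right.
- rewrite (inv_beta I); apply: perm_threshold.
  by rewrite -{1}(setD1K eS) perm_weights_setU1.
- by rewrite -{1}(setD1K eS) block_weight_setU1.
Qed.

Lemma accept s A SS w beta Z t (a := part t) (y := f (t |: SS) - f SS) :
    invariant s A SS w beta -> t \notin s -> beta a <= y -> Z t ->
  exists SS' w' beta', exists x,
  [/\ step Z (SS, w, beta) t = (SS', w', beta'),
      invariant (rcons s t) (t |: A) SS' w' beta',
      forall b, b != a -> beta' b = beta b /\
                          block_weight w' SS' b = block_weight w SS b,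
      block_weight w' SS' a = block_weight w SS a + y - x &
      [/\ 0 <= x, (1 + d a) * x <= d a * beta a, x <= y, beta a <= beta' a &
          (n a)%:R * (beta' a - beta a) <=
            cc (d a) (n a) * y + d a * beta a - (1 + d a + cc (d a) (n a)) * x]].
Proof.
move=> I ts by_ Zt; have tA : t \notin A by apply: contra ts; apply: inv_proc I t.
have tS : t \notin SS by apply: contra tA => /(subsetP (inv_sub I)).
rewrite /Defs.step -/a -/y by_ Zt /=.
have [x] := evict t I; rewrite -/a; set K := if _ then _ else _.
move=> /=; set ws := weights w K a.
move=> [[KS KE] [x0 ws_ge] [size_ws x_or] betaE WE].
have -> : (if (#|SS :&: block a| < n a)%N then t |: SS
   else t |: SS :\ choose t (SS :&: block a) w) = t |: K.
  by rewrite /K; case: ifP.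
pose w' u := if u == t then y else w u.
pose beta' b := if b == a
  then threshold (d a) (n a) (weights w' (t |: K) a) else beta b.
have tK : t \notin K by apply: contra tS => /(subsetP KS).
have w't : w' t = y by rewrite /w' eqxx.
have w'E : {in SS, w' =1 w}.
  by move=> u uS; rewrite /w'; case: eqP => // ut; rewrite -ut uS in tS.
have w'K : {in K, w' =1 w} by move=> u /(subsetP KS)/w'E.
have wt_perm : perm_eq (weights w' (t |: K) a) (y :: ws).
  rewrite -w't /ws -(@eq_weights w' w K a) //; exact: perm_weights_setU1.
have tb b : b != a -> (t |: K) :&: block b = SS :&: block b.
  move=> ba; rewrite -KE //; apply/setP => u; rewrite !inE.
  by case: eqP => //= ->; rewrite eq_sym (negPf ba) andbF.
have beta'E b : beta' b = threshold (d b) (n b) (weights w' (t |: K) b).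
  rewrite /beta'; case: eqP => [->//|/eqP ba].
  rewrite (inv_beta I) /weights tb //; congr threshold.
  by apply/eq_in_map => u; rewrite mem_enum inE => /andP[/w'E].
have beta'a : beta' a = threshold (d a) (n a) (y :: ws).
  by rewrite beta'E; apply: perm_threshold.
have [lb xy bb' upd] : [/\ (1 + d a) * x <= d a * beta a, x <= y,
    beta a <= beta' a & (n a)%:R * (beta' a - beta a) <=
      cc (d a) (n a) * y + d a * beta a - (1 + d a + cc (d a) (n a)) * x].
  by rewrite beta'a betaE; apply: threshold_update => //; rewrite -betaE.
exists (t |: K), w', beta', x; split=> //.
- split.
  + by rewrite setUS // (subset_trans KS) // (inv_sub I).
  + move=> u; rewrite in_setU1 mem_rcons in_cons.
    by case: eqP => //= _; apply: inv_proc I u.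
  + move=> b; have [->|ba] := eqVneq b a; last by rewrite tb // (inv_card I).
    by rewrite -(size_weights w') (perm_size wt_perm).
  + move=> u; rewrite in_setU1 => /predU1P[->|/(subsetP KS) uS].
      by rewrite w't (le_trans x0).
    by rewrite w'E // (inv_w_ge0 I).
  + exact: beta'E.
  (* The value bound is kept for all subsets of the solution, so it survives evictions. *)
  + move=> X XK; have [tX|tX] := boolP (t \in X); last first.
      have XS : X \subset SS.
        apply/subsetP => u uX; have := subsetP XK u uX.
        rewrite in_setU1 => /predU1P[ut|]; first by rewrite -ut uX in tX.
        exact: (subsetP KS).
      rewrite (eq_bigr w); first exact: inv_value I X XS.
      by move=> u /(subsetP XS)/w'E.
    have XS : X :\ t \subset SS.
      apply/subsetP => u; rewrite !inE => /andP[/negPf ut uX].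
      by have := subsetP XK u uX; rewrite in_setU1 ut => /(subsetP KS).
    rewrite (big_setD1 t) //= w't (eq_bigr w); last first.
      by move=> u /(subsetP XS)/w'E.
    have := inv_value I XS.
    (* The weight [y] is a marginal over [SS], hence at most the one over [X :\ t]. *)
    have := submodular_marginal f_sub XS (fun tS' => False_ind _ (negP tS tS')).
    by rewrite -/y setD1K //; lra.
- move=> b ba; split; first by rewrite /beta' (negPf ba).
  rewrite /block_weight tb //; apply: eq_bigr => u.
  by rewrite inE => /andP[/w'E].
- rewrite block_weight_setU1 // w't WE.
  suff -> : block_weight w' K a = block_weight w K a by ring.
  by apply: eq_bigr => u; rewrite inE => /andP[/w'K].
Qed.

(** The left side bounds the expected change of the potential for a weight [y] reaching the
    threshold [b]; [r] slots remain afterwards, and [e] tells whether the element is in [Sstar]. For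
    [e = 0] up to [N] slots pay for the growth of the threshold, covered by [1 + C + D]. For [e = 1]
    at most [N - 1] do, and [1 / p] covers the weight, which is paid whatever the coin shows. *)
Lemma potential_ineq (D N C Q b b' x y r e : R) :
    0 < D -> p * D <= 1 -> 1 <= N -> 0 <= C ->
    1 + C + D <= Q -> p * ((1 - N^-1) * C) + 1 <= p * Q ->
    0 <= x -> (1 + D) * x <= D * b -> x <= y -> b <= y -> b <= b' ->
    N * (b' - b) <= C * y + D * b - (1 + D + C) * x ->
    0 <= r <= N - e -> e = 0 \/ e = 1 ->
  p * (y + r * b' - (r + e) * b - Q * (y - x)) + (1 - p) * (e * (y - b)) <= 0.
Proof.
move=> D0 pD N1 C0 Q1 Q2 x0 lb xy by_ bb' upd.
have p_ge0 := ltW p_gt0; move=> /andP[r0 rN] [] eE; subst e.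
  have h1 : r * (b' - b) <= N * (b' - b) by rewrite ler_wpM2r ?subr_ge0 //; lra.
  have h2 : (1 + C + D) * (y - x) <= Q * (y - x) by rewrite ler_wpM2r ?subr_ge0.
  have h3 : D * b <= D * y by rewrite ler_pM2l.
  have h : y + r * b' - (r + 0) * b - Q * (y - x) <= 0 by lra.
  by have := mulr_ge0_le0 (ltW p_gt0) h; lra.
have N0 : 0 < N by lra.
set K := 1 - N^-1 in Q2 *.
have iN : N^-1 <= 1 by rewrite invf_le1.
have K01 : 0 <= K <= 1 by rewrite /K; have := invr_ge0 N; lra.
have h1 : r * (b' - b) <= (N - 1) * (b' - b) by rewrite ler_wpM2r ?subr_ge0.
have KN : K * N = N - 1 by rewrite /K mulrBl mulVf ?mul1r // gt_eqF.
have /andP[K0 K1] := K01.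
have := ler_wpM2l K0 upd; rewrite mulrA KN => h2.
have h3 : p * (r * (b' - b)) <= p * (K * (C * y + D * b - (1 + D + C) * x)).
  by rewrite ler_wpM2l //; lra.
have h4 : (p * (K * C) + 1) * (y - x) <= p * Q * (y - x).
  by rewrite ler_wpM2r ?subr_ge0.
(* The growth left once the multiples of [y - x] cancel. As [p * D <= 1],
   [D * (p * v) <= v <= D * (b - x)], so [x - b] absorbs it. *)
pose v := D * b - (1 + D) * x.
have v0 : 0 <= v by rewrite subr_ge0.
have h5 : p * (K * v) <= p * v by rewrite ler_wpM2l // ler_piMl.
have h6 : D * (p * v) <= v by rewrite mulrA (mulrC D) ler_piMl.
have h7 : p * v <= b - x by rewrite -(ler_pM2l D0) /v in h6 *; nra.
by rewrite /v in h5 h7; lra.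
Qed.

(** * The potential relative to the optimal set *)

Variable Sstar : {set 'I_m}.
Hypothesis Sstar_feasible : feasible part n Sstar.

Definition seen s : {set 'I_m} := [set u in Sstar | u \in s].

Definition slots s a : R := (n a)%:R - #|seen s :&: block a|%:R.

Local Notation Q a := (QQ p (d a) (n a)).

(* Its expectation never increases during the run. *)
Definition potential s A SS w beta : R :=
  f (seen s :|: A) + \sum_a slots s a * beta a
  - \sum_a Q a * block_weight w SS a.

Lemma slots_ge0 s a : 0 <= slots s a.
Proof.
rewrite subr_ge0 ler_nat (leq_trans _ (Sstar_feasible a)) // subset_leq_card //.
by apply/subsetP => u; rewrite !inE => /andP[/andP[-> _] ->].
Qed.

Lemma slots_le s a : slots s a <= (n a)%:R.
Proof. by rewrite gerBl. Qed.

Lemma seen_rcons s t :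
  seen (rcons s t) = if t \in Sstar then t |: seen s else seen s.
Proof.
case: ifPn => tS; apply/setP => u; rewrite !inE mem_rcons in_cons.
  by case: eqP => //= ->; rewrite tS.
by case: eqP => //= ->; rewrite (negPf tS).
Qed.

Lemma slots_rcons s t a : t \notin s ->
  slots (rcons s t) a = slots s a - (if a == part t then (t \in Sstar)%:R else 0).
Proof.
move=> ts; rewrite /slots seen_rcons; case: ifPn => tS; last by rewrite if_same subr0.
have tseen : t \notin seen s by rewrite inE (negPf ts) andbF.
case: eqP => [->|ap].
  rewrite (_ : _ :&: _ = t |: (seen s :&: block (part t))); last first.
    by apply/setP => u; rewrite !inE; case: eqP => //= ->; rewrite eqxx.
  by rewrite cardsU1 inE (negPf tseen) /= natrD; ring.
rewrite subr0 (_ : _ :&: _ = seen s :&: block a) //.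
apply/setP => u; rewrite !inE; case: eqP => //= ->.
by rewrite (negPf ts) andbF; case: eqP ap => // ->.
Qed.

(** The union contains [SS] and misses [t], so diminishing returns apply. *)
Lemma f_union_le s A SS w beta t : invariant s A SS w beta -> t \notin s ->
  f (t |: (seen s :|: A)) <= f (seen s :|: A) + (f (t |: SS) - f SS).
Proof.
move=> I ts; rewrite addrC -lerBlDr; apply: submodular_marginal => //.
  exact: subset_trans (inv_sub I) (subsetUr _ _).
rewrite !inE (negPf ts) andbF /= => /(inv_proc I); by rewrite (negPf ts).
Qed.

(** An element of [Sstar] joins the union even if rejected, gaining at most its weight, and frees
    the threshold held by its slot. *)
Lemma potential_reject s A SS w beta t (e : R := (t \in Sstar)%:R) :
    invariant s A SS w beta -> t \notin s ->
  potential (rcons s t) A SS w beta <=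
  potential s A SS w beta + e * (f (t |: SS) - f SS - beta (part t)).
Proof.
move=> I ts; rewrite /potential.
rewrite (bigD1 (part t)) //= [X in _ <= _ + X - _ + _](bigD1 (part t)) //=.
rewrite slots_rcons // eqxx -/e (eq_bigr (fun a => slots s a * beta a)); last first.
  by move=> a /negPf ap; rewrite slots_rcons // ap subr0.
suff : f (seen (rcons s t) :|: A) <=
    f (seen s :|: A) + e * (f (t |: SS) - f SS) by lra.
rewrite seen_rcons /e; case: ifP => _; last by rewrite mul0r addr0.
by rewrite -setUA mul1r (f_union_le I ts).
Qed.

(** All blocks other than [a] cancel; [z] will be [y - x]. *)
Lemma potential_accept s A SS w beta SS' w' beta' t (a := part t)
    (e : R := (t \in Sstar)%:R) (z : R) :
    invariant s A SS w beta -> t \notin s ->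
    (forall b, b != a -> beta' b = beta b /\
       block_weight w' SS' b = block_weight w SS b) ->
    block_weight w' SS' a = block_weight w SS a + z ->
  potential (rcons s t) (t |: A) SS' w' beta' <=
  potential s A SS w beta + (f (t |: SS) - f SS)
    + (slots s a - e) * beta' a - slots s a * beta a - Q a * z.
Proof.
move=> I ts same Wa; rewrite /potential.
rewrite (bigD1 a) //= [X in _ - X <= _](bigD1 a) //=.
rewrite [X in _ <= _ + X - _ + _ + _ - _ - _](bigD1 a) //=.
rewrite [X in _ <= _ + _ - X + _ + _ - _ - _](bigD1 a) //=.
rewrite slots_rcons // eqxx -/e (eq_bigr (fun a => slots s a * beta a)); last first.
  by move=> b ba; rewrite slots_rcons // (negPf ba) subr0 (same b ba).1.
rewrite [X in _ - (_ + X) <= _](eq_bigr (fun b => Q b * block_weight w SS b)); last first.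
  by move=> b ba; rewrite (same b ba).2.
rewrite Wa.
suff : f (seen (rcons s t) :|: (t |: A)) <=
    f (seen s :|: A) + (f (t |: SS) - f SS) by lra.
have -> : seen (rcons s t) :|: (t |: A) = t |: (seen s :|: A).
  rewrite seen_rcons; case: ifP => _; apply/setP => u; rewrite !in_setU !in_set1;
    by case: (u == t); rewrite ?orbT.
exact: f_union_le I ts.
Qed.

(** * The expected potential along the run *)

(** The accepted set is carried along because the state forgets evicted elements. *)
Definition trace_step Z (xs : {set 'I_m} * state R m k) t :=
  let: (A, (SS, w, beta)) := xs in
  (if (beta (part t) <= f (t |: SS) - f SS) && Z t then t |: A else A,
   step Z (SS, w, beta) t).

Definition trace Z s : {set 'I_m} * state R m k :=
  foldl (trace_step Z) (set0, (set0, fun=> 0, fun=> 0)) s.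

Definition trace_inv s (xs : {set 'I_m} * state R m k) :=
  let: (A, (SS, w, beta)) := xs in invariant s A SS w beta.

Definition trace_pot s (xs : {set 'I_m} * state R m k) :=
  let: (A, (SS, w, beta)) := xs in potential s A SS w beta.

Lemma trace_rcons Z s t : trace Z (rcons s t) = trace_step Z (trace Z s) t.
Proof. by rewrite /trace foldl_rcons. Qed.

Lemma trace_state Z s :
  (trace Z s).2 = foldl (step Z) (set0, fun=> 0, fun=> 0) s.
Proof.
elim/last_ind: s => // s t IHs; rewrite trace_rcons foldl_rcons -IHs.
by case: (trace Z s) => A [[SS w] beta].
Qed.

Lemma trace_step_eq Z Z' xs t : Z t = Z' t ->
  trace_step Z xs t = trace_step Z' xs t.
Proof.
by case: xs => A [[SS w] beta] ZZ'; rewrite /trace_step /Defs.step ZZ'.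
Qed.

(** This makes the past independent of the next coin, as [expect_coord] requires. *)
Lemma trace_eq Z Z' s : {in s, Z =1 Z'} -> trace Z s = trace Z' s.
Proof.
elim/last_ind: s => // s t IHs ZZ'; rewrite !trace_rcons IHs.
  by apply: trace_step_eq; apply: ZZ'; rewrite mem_rcons mem_head.
by move=> u us; apply: ZZ'; rewrite mem_rcons in_cons us orbT.
Qed.

Lemma trace_accepted Z s t : t \in (trace Z s).1 -> Z t.
Proof.
elim/last_ind: s => [|s u IHs]; first by rewrite inE.
rewrite trace_rcons; case: (trace Z s) IHs => A [[SS w] beta] /= IHs.
by case: ifP => [/andP[_ Zu]|_] //; rewrite in_setU1 => /predU1P[->|/IHs].
Qed.

Lemma trace_reject Z A SS w beta t :
  ~~ ((beta (part t) <= f (t |: SS) - f SS) && Z t) ->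
  trace_step Z (A, (SS, w, beta)) t = (A, (SS, w, beta)).
Proof. by move=> /negPf rej; rewrite /trace_step /Defs.step rej. Qed.

Lemma invariant_rcons s A SS w beta t :
  invariant s A SS w beta -> invariant (rcons s t) A SS w beta.
Proof.
case=> I1 I2 I3 I4 I5 I6; split=> // u /I2.
by rewrite mem_rcons in_cons orbC => ->.
Qed.

Lemma trace_step_inv Z s xs t : trace_inv s xs -> t \notin s ->
  trace_inv (rcons s t) (trace_step Z xs t).
Proof.
case: xs => A [[SS w] beta] I ts.
have [acc|rej] := boolP ((beta (part t) <= f (t |: SS) - f SS) && Z t); last first.
  by rewrite trace_reject //; apply: invariant_rcons.
rewrite /trace_step acc; case/andP: acc => by_ Zt.
by have [SS' [w' [beta' [x [-> I' _ _ _]]]]] := accept I ts by_ Zt.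
Qed.

Lemma invariant0 : invariant [::] set0 set0 (fun=> 0) (fun=> 0).
Proof.
split=> [|t|a|t|a|X]; rewrite ?inE ?sub0set //.
- by rewrite set0I cards0.
- rewrite /weights set0I enum_set0 /threshold big1 // => i _.
  by rewrite /kth_largest nth_nil mul0r.
- by rewrite subset0 => /eqP->; rewrite big_set0 addr0.
Qed.

Lemma trace_invP Z s : uniq s -> trace_inv s (trace Z s).
Proof.
elim/last_ind: s => [_|s t IHs]; first exact: invariant0.
by rewrite rcons_uniq trace_rcons => /andP[ts /IHs I]; apply: trace_step_inv.
Qed.

(** The step reads only the coin of [t], so constant coin families stand for its two outcomes. *)
Lemma potential_step s xs t : trace_inv s xs -> t \notin s ->
  p * trace_pot (rcons s t) (trace_step [ffun=> true] xs t)
  + (1 - p) * trace_pot (rcons s t) (trace_step [ffun=> false] xs t)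
  <= trace_pot s xs.
Proof.
case: xs => A [[SS w] beta] I ts.
have p0 := ltW p_gt0.
have q0 : 0 <= 1 - p by rewrite subr_ge0.
rewrite (@trace_reject [ffun=> false]) ?ffunE ?andbF //.
have rej := potential_reject I ts.
(* Below the threshold both outcomes reject, and the weight gained is less than the threshold
   released. *)
have [by_|] := leP (beta (part t)) (f (t |: SS) - f SS); last first.
  move=> yb; rewrite trace_reject ?(lt_geF yb) //= -mulrDl subrKC mul1r.
  rewrite (le_trans rej) // gerDl mulr_ge0_le0 ?ler0n //.
  by rewrite subr_le0 ltW.
rewrite /trace_step ffunE by_ /trace_pot andbT.
have [SS' [w' [beta' [x [-> I' same Wa [x0 lb xy bb' upd]]]]]] :=
  accept I ts by_ (ffunE (fun=> true) t).
have := potential_accept I ts same (etrans Wa (esym (addrA _ _ _))).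
move: rej; set a := part t in upd bb' lb *; set y := f _ - f _.
set e : R := (t \in Sstar)%:R; set P := potential s A SS w beta.
move=> rej acc.
have d0 := d_gt0 a; have n0 := n_gt0 a.
have Ngt0 : 0 < (n a)%:R :> R by rewrite ltr0n.
have slotsE : slots (rcons s t) a = slots s a - e by rewrite slots_rcons // eqxx.
have r_ge0 : 0 <= slots s a - e by rewrite -slotsE slots_ge0.
have := @potential_ineq (d a) (n a)%:R (cc (d a) (n a)) (Q a) (beta a) (beta' a)
  x y (slots s a - e) e d0 (pd_le1 a).
rewrite ler1n n0 (ltW (cc_gt0 d0 n0)) => /(_ isT isT).
have Q1 : 1 + cc (d a) (n a) + d a <= Q a by rewrite le_max lexx.
have Q2 : p * ((1 - (n a)%:R^-1) * cc (d a) (n a)) + 1 <= p * Q a.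
  have : (1 - (n a)%:R^-1) * cc (d a) (n a) + p^-1 <= Q a by rewrite le_max lexx orbT.
  by rewrite -(ler_pM2l p_gt0) mulrDr mulfV // gt_eqF.
move=> /(_ Q1 Q2 x0 lb xy by_ bb' upd).
rewrite r_ge0 lerD2r slots_le subrK => /(_ isT).
have e01 : e = 0 \/ e = 1 by rewrite /e; case: (_ \in _); [right|left].
move=> /(_ e01) ineq.
have acc' := ler_wpM2l p0 acc; have rej' := ler_wpM2l q0 rej.
by apply: le_trans (lerD acc' rej') _; lra.
Qed.

Lemma expect_potential s : uniq s ->
  expect p (fun Z => trace_pot s (trace Z s)) <= f set0.
Proof.
have p01 : 0 <= p <= 1 by rewrite ltW.
elim/last_ind: s => [_|s t IHs].
  rewrite expect_cst /= /potential setU0.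
  rewrite (_ : seen [::] = set0); last by apply/setP => u; rewrite !inE andbF.
  rewrite big1 => [|a _]; last by rewrite mulr0.
  rewrite big1 ?subr0 ?addr0 // => a _.
  by rewrite /block_weight set0I big_set0 mulr0.
rewrite rcons_uniq => /andP[ts us]; apply: le_trans (IHs us).
pose G b Z := trace_pot (rcons s t) (trace_step [ffun=> b] (trace Z s) t).
rewrite (_ : expect _ _ = expect p (fun Z => G (Z t) Z)); last first.
  apply: eq_bigr => Z _; rewrite trace_rcons /G; congr (_ * trace_pot _ _).
  by apply: trace_step_eq; rewrite ffunE.
rewrite expect_coord; last first.
  move=> b Z; rewrite /G (@trace_eq (flip t Z) Z) // => u us'.
  by rewrite ffunE; case: eqP => // ut; rewrite -ut us' in ts.
by apply: ler_expect => // Z; apply: potential_step => //; apply: trace_invP.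
Qed.

(** At the end [seen s] is [Sstar], and [rho * Q <= 1 - p] turns the block weights in the potential
    into [1 - p] times the stored weights, which [f] of the output dominates. [sampling] and
    [expect_potential] then bound the two expectations. *)
Lemma expected_value_ge (rho : R) : 0 <= rho <= 1 - p ->
    (forall a, rho * Q a <= 1 - p) ->
  rho * f Sstar <= expected_value f part n p d choose.
Proof.
move=> /andP[rho0 rho1] rhoQ; have p01 : 0 <= p <= 1 by rewrite ltW.
pose s := enum 'I_m; have us : uniq s := enum_uniq _.
have := expect_potential us.
have := sampling f_sub f_ge0 Sstar p01 (fun Z => @trace_accepted Z s).
set E1 := expect p _; set E2 := expect p _ => E1_ge E2_le.
have q0 : 0 <= 1 - p by rewrite subr_ge0.
(* The factor [1 - p] is cancelled at the end; if it vanishes, so does [rho]. *)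
have [p1|p_lt1] := eqVneq p 1.
  have -> : rho = 0 by apply/le_anti; rewrite rho0; move: rho1; rewrite p1 subrr => ->.
  rewrite mul0r -[X in X <= _](expect_cst m p).
  by apply: ler_expect.
have q_gt0 : 0 < 1 - p by rewrite subr_gt0 lt_neqAle p_lt1.
have bound Z : rho * f (Sstar :|: (trace Z s).1) - rho * trace_pot s (trace Z s)
    + (1 - p) * f set0 <= (1 - p) * f (run f part n d choose Z).
  rewrite /run -/(foldl _ _ _) -trace_state -/s.
  have := trace_invP Z us; case: (trace Z s) => A [[SS w] beta] /= I.
  have seenE : seen s = Sstar by apply/setP => u; rewrite inE mem_enum andbT.
  rewrite /potential seenE.
  have slots0 : 0 <= \sum_a slots s a * beta a.
    by apply: sumr_ge0 => a _; rewrite mulr_ge0 ?slots_ge0 ?(beta_ge0 _ I).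
  have W_le : rho * \sum_a Q a * block_weight w SS a <=
      (1 - p) * \sum_(t in SS) w t.
    rewrite (partition_big part predT) //= !mulr_sumr; apply: ler_sum => a _.
    rewrite mulrA (_ : \sum_(t in SS | part t == a) w t = block_weight w SS a).
      apply: ler_wpM2r => //; apply: sumr_ge0 => t.
      by rewrite inE => /andP[/(inv_w_ge0 I)].
    by apply: eq_bigl => t; rewrite !inE.
  have := inv_value I (subxx SS); rewrite -(ler_pM2l q_gt0) mulrDr.
  by have := mulr_ge0 rho0 slots0; lra.
have := ler_expect p01 bound.
rewrite expectZ !expectD expect_cst expectZ -/E1.
rewrite (_ : expect p (fun Z => - (rho * _)) = - (rho * E2)); last first.
  by rewrite -mulNr -expectZ; apply: eq_bigr => Z _; rewrite mulNr.
rewrite -[expected_value _ _ _ _ _ _]/(expect p (fun Z =>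
  f (run f part n d choose Z))).
have := ler_wpM2l rho0 E1_ge; have := ler_wpM2l rho0 E2_le.
(* The initial potential costs [rho * f set0], absorbed by [(1 - p) * f set0]. *)
have := ler_wpM2r (f_ge0 set0) rho1.
set E := expect p _ => h1 h2 h3 h4.
rewrite -(ler_pM2l q_gt0) mulrCA.
by lra.
Qed.

Lemma expected_value_ge_ratio (rho : R) : (0 < k)%N -> 0 <= rho ->
    (forall a, rho <= (1 - p) / Q a) ->
  rho * f Sstar <= expected_value f part n p d choose.
Proof.
move=> k_gt0 rho0 rhoQ.
have Q1 a : 1 <= Q a.
  have := cc_gt0 (d_gt0 a) (n_gt0 a); have := d_gt0 a.
  have : 1 + cc (d a) (n a) + d a <= Q a by rewrite le_max lexx.
  by lra.
have rhoQ' a : rho * Q a <= 1 - p.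
  by rewrite -ler_pdivlMr ?rhoQ // (lt_le_trans ltr01).
apply: expected_value_ge => //; rewrite rho0 /=.
(* Any block gives [rho <= rho * Q <= 1 - p]. *)
by apply: le_trans (rhoQ' (Ordinal k_gt0)); rewrite ler_peMr.
Qed.

End Run.

(** * Numerical estimates of the ratios *)

Section Ratio.
Variable R : realFieldType.
Implicit Types (p d v : R) (n i j : nat).

(** The ratio is a product of factors [(n - i) / n], [i < j], with truncated subtraction; a product
    of numbers in the unit interval is at least one minus the sum of their defects. *)
Lemma ffact_ratio_bounds n j : (0 < n)%N ->
  let u : R := (n ^_ j)%:R / n%:R ^+ j in
  0 <= u <= 1 /\ 1 - (j * j.-1)%:R / 2 / n%:R <= u.
Proof.
move=> n0; have n0' : 0 < n%:R :> R by rewrite ltr0n.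
have nN0 : n%:R != 0 :> R by rewrite gt_eqF.
elim: j => [|j [/andP[u0 u1] lb]] /=.
  by rewrite ffactn0 expr0 divr1 ler01 lexx !mul0r subr0.
set u := (n ^_ j)%:R / _ in u0 u1 lb.
have -> : (n ^_ j.+1)%:R / n%:R ^+ j.+1 = u * ((n - j)%:R / n%:R) :> R.
  rewrite ffactnSr natrM exprS /u; field.
  by rewrite expf_neq0 nN0.
have r0 : 0 <= (n - j)%:R / n%:R :> R by rewrite divr_ge0.
have r1 : (n - j)%:R / n%:R <= 1 :> R.
  by rewrite ler_pdivrMr // mul1r ler_nat leq_subr.
have rj : 1 - j%:R / n%:R <= (n - j)%:R / n%:R :> R.
  rewrite -[X in X - _](mulfV nN0) -mulrBl ler_pM2r ?invr_gt0 //.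
  by rewrite lerBlDr -natrD ler_nat addnC -leq_subLR.
split; first by rewrite mulr_ge0 //= mulr_ile1.
have -> : (j.+1 * j)%:R / 2 / n%:R = (j * j.-1)%:R / 2 / n%:R + j%:R / n%:R :> R.
  case: j {u u0 u1 lb r0 r1 rj} => [|j]; first by rewrite muln0 !mul0r addr0.
  rewrite /= !natrM -!natr1; field.
  by rewrite gt_eqF.
have y0 : 0 <= j%:R / n%:R :> R by rewrite divr_ge0.
set y := j%:R / _ in rj y0 *; set r := _ / _ in r0 r1 rj *.
have := ler_wpM2l u0 rj; have : u * y <= 1 * y by rewrite ler_wpM2r.
by lra.
Qed.

(** The binomial term of degree [i] is [d ^+ i / i!] times the ratio just bounded; omitted terms are
    nonnegative. *)
Lemma expr_ge_trunc d n J : 0 <= d -> (0 < n)%N -> (J <= n)%N ->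
  \sum_(0 <= i < J.+1) d ^+ i / i`!%:R * (1 - (i * i.-1)%:R / 2 / n%:R)
  <= (1 + d / n%:R) ^+ n.
Proof.
move=> d0 n0 Jn; have n0' : 0 < n%:R :> R by rewrite ltr0n.
have termE i : (d / n%:R) ^+ i *+ 'C(n, i) =
    d ^+ i / i`!%:R * ((n ^_ i)%:R / n%:R ^+ i) :> R.
  rewrite -bin_ffact natrM -mulr_natr expr_div_n; field.
  by rewrite expf_neq0 ?gt_eqF //= ltr0n fact_gt0.
have t0 i : 0 <= d ^+ i / i`!%:R :> R by rewrite divr_ge0 ?exprn_ge0.
rewrite exprDn -(big_mkord xpredT (fun i => 1 ^+ (n - i) * (d / n%:R) ^+ i *+ 'C(n, i))).
rewrite [X in _ <= X](big_cat_nat (n := J.+1)) //= -[X in X <= _]addr0 lerD //.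
  apply: ler_sum => i _; rewrite expr1n mul1r termE ler_wpM2l //.
  exact: (ffact_ratio_bounds i n0).2.
apply: sumr_ge0 => i _; rewrite expr1n mul1r termE mulr_ge0 //.
by have [/andP[]] := ffact_ratio_bounds i n0.
Qed.

(** The last two hypotheses are [v * Q <= 1 - p] for either term of the maximum, multiplied by
    [q - 1] to clear [cc]. *)
Lemma ratio_ge p d n v (q := (1 + d / n%:R) ^+ n) :
    0 < p -> 0 < d -> (0 < n)%N -> 0 <= v ->
    v * (1 + d) * q <= (1 - p) * (q - 1) ->
    v * ((1 - n%:R^-1) * (1 + d) + (q - 1) / p) <= (1 - p) * (q - 1) ->
  v <= (1 - p) / QQ p d n.
Proof.
move=> p0 d0 n0 v0 h1 h2; have n0' : 0 < n%:R :> R by rewrite ltr0n.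
have q1 : 0 < q - 1.
  by rewrite subr_gt0 exprn_egt1 -?lt0n // ltrDl divr_gt0.
have c0 := cc_gt0 d0 n0.
have cE : cc d n * (q - 1) = 1 + d.
  by rewrite mulrBr mulr1 (cc_eq d0 n0) addrK.
have Q0 : 0 < QQ p d n by rewrite lt_max (addr_gt0 (addr_gt0 ltr01 c0) d0).
rewrite ler_pdivlMr // /QQ /Num.max; case: ifP => _.
  rewrite -(ler_pM2r q1) -mulrA mulrDl -mulrA cE; apply: le_trans h2.
  by rewrite (mulrC p^-1).
rewrite -(ler_pM2r q1) -mulrA; apply: le_trans h1; rewrite -mulrA ler_wpM2l //.
by rewrite addrAC mulrDl cE mulrBr mulr1 subrK.
Qed.

(* When [1 / p = 1 + d] the first term of [QQ] is the larger one. *)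
Lemma ratio_ge_balanced p d n v (q := (1 + d / n%:R) ^+ n) :
    0 < d -> p * (1 + d) = 1 -> (0 < n)%N -> 0 <= v ->
    1 - p <= q * ((1 - p) - v * (1 + d)) ->
  v <= (1 - p) / QQ p d n.
Proof.
move=> d0 pd n0 v0 h.
have d1 : 0 < 1 + d by lra.
have p0 : 0 < p by rewrite -(pmulr_lgt0 _ d1) pd.
have pV : p^-1 = 1 + d by apply: (mulfI (lt0r_neq0 p0)); rewrite pd mulfV ?lt0r_neq0.
apply: ratio_ge => //; rewrite -/q; first by lra.
rewrite pV; have : 0 <= v * (n%:R^-1 * (1 + d)).
  by rewrite !mulr_ge0 ?invr_ge0 // ltW.
by lra.
Qed.

Lemma inv_n_bounds n : (11 <= n)%N -> 0 <= (n%:R^-1 : R) <= 11%:R^-1.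
Proof.
move=> n11; rewrite invr_ge0 ler0n lef_pV2 ?ler_nat //= posrE ltr0n //.
exact: leq_trans n11.
Qed.

Lemma expr_ge_trunc8 d n (x : R := n%:R^-1) : 0 <= d -> (11 <= n)%N ->
  1 + d + d ^+ 2 / 2 * (1 - x) + d ^+ 3 / 6 * (1 - 3 * x)
  + d ^+ 4 / 24 * (1 - 6 * x) + d ^+ 5 / 120 * (1 - 10 * x)
  + d ^+ 6 / 720 * (1 - 15 * x) + d ^+ 7 / 5040 * (1 - 21 * x)
  + d ^+ 8 / 40320%:R * (1 - 28 * x) <= (1 + d * x) ^+ n.
Proof.
move=> d0 n11; have n0 : (0 < n)%N by apply: leq_trans n11.
have := expr_ge_trunc d0 n0 (@leq_trans 11 8 n isT n11); apply: le_trans.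
rewrite !big_nat_recr //= big_geq // !factS fact0 !natrM -/x.
by lra.
Qed.

Lemma ratio_small_big n : (11 <= n)%N ->
  1896%:R / 10000%:R * (1 - 7771%:R / 10000%:R / n%:R)
  <= (1 - p_small R) / QQ (p_small R) ((1 - p_small R) / p_small R) n.
Proof.
move=> n11; have n0 : (0 < n)%N by apply: leq_trans n11.
have -> : (1 - p_small R) / p_small R = 7 / 3 by rewrite /p_small; field.
have /andP[x0 x1] := inv_n_bounds n11.
have d0 : 0 <= 7 / 3 :> R by lra.
have := expr_ge_trunc8 d0 n11.
set x := n%:R^-1 in x0 x1 *; set q := (1 + _) ^+ n => trunc.
(* The truncation is affine in [x]: constant term rounded down, slope rounded up. *)
have {}trunc : 10304%:R / 1000 - 28 * x <= q by lra.
apply: ratio_ge_balanced; rewrite -/x -/q /p_small //; try lra.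
set L := (X in _ <= q * X); have L0 : 0 <= L by rewrite /L; lra.
apply: le_trans (ler_wpM2r L0 trunc).
(* The goal is quadratic in [x]; the bound [x ^+ 2 <= x / 11] makes it linear. *)
have x1' : 0 <= 11^-1 - x by rewrite subr_ge0.
have := mulr_ge0 x0 x1'; rewrite /L; lra.
Qed.

(** For large [n] the ratio tends to [d * (1 - exp (- d)) / (1 + d) ^+ 2], about 0.1922; the
    equation behind [d_large] says that its derivative in [d] vanishes. *)
Lemma ratio_large n : (11 <= n)%N ->
  1921%:R / 10000%:R * (1 - 7676%:R / 10000%:R / n%:R)
  <= (1 - p_large R) / QQ (p_large R) (d_large R) n.
Proof.
move=> n11; have n0 : (0 < n)%N by apply: leq_trans n11.
have /andP[x0 x1] := inv_n_bounds n11.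
have d0 : 0 < d_large R by rewrite /d_large; lra.
have := expr_ge_trunc8 (ltW d0) n11.
have pE : p_large R = 10000%:R / 29532%:R by rewrite /p_large /d_large; field.
set x := n%:R^-1 in x0 x1 *; set q := (1 + _) ^+ n => trunc.
have {}trunc : 7049%:R / 1000 - 134 / 10 * x <= q.
  by apply: le_trans trunc; rewrite /d_large; lra.
apply: ratio_ge_balanced; rewrite -/x -/q ?pE //; try lra.
  by rewrite /d_large; lra.
set L := (X in _ <= q * X); have L0 : 0 <= L by rewrite /L /d_large; lra.
apply: le_trans (ler_wpM2r L0 trunc).
have x1' : 0 <= 11^-1 - x by rewrite subr_ge0.
have := mulr_ge0 x0 x1'; rewrite /L /d_large; lra.
Qed.

Lemma d_small_bounds n : (0 < n)%N -> 0 < d_small R n <= 7%:R / 3%:R.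
Proof.
do 11![case: n => [|n]; first by rewrite /d_small /p_small; lra].
by rewrite /d_small /p_small; lra.
Qed.

Lemma ratio_small n : (0 < n)%N ->
  small_lb R n <= (1 - p_small R) / QQ (p_small R) (d_small R n) n.
Proof.
case: (leqP 11 n) => [n11 _|].
  by case: n n11 => // n; do 10![case: n => // n]; apply: ratio_small_big.
(* For each of the ten budgets, [ratio_ge] leaves inequalities between rational numbers. *)
case: n => // n; do 10![case: n => [_ _|n //]; first by
  apply: ratio_ge; rewrite /p_small /d_small /small_lb //; lra].
Qed.

Lemma small_lb_ge n : (0 < n)%N -> 175%:R / 1000%:R <= small_lb R n.
Proof.
case: (leqP 11 n) => [n11 _|].
  have /andP[_ x1] := inv_n_bounds n11.
  have -> : small_lb R n = 1896%:R / 10000%:R * (1 - 7771%:R / 10000%:R / n%:R).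
    by case: n n11 {x1} => // n; do 10![case: n => // n].
  by lra.
by case: n => // n; do 10![case: n => [_ _|n //]; first by rewrite /small_lb; lra].
Qed.

End Ratio.

(** * Minima over the blocks and the two parameter settings *)

Lemma minf_le (R : realFieldType) k (r : 'I_k -> R) a : minf r <= r a.
Proof. exact: bigmin_le. Qed.

Lemma minf_ge0 (R : realFieldType) k (r : 'I_k -> R) :
  (forall a, 0 <= r a) -> 0 <= minf r.
Proof.
move=> r0; apply: le_bigmin => [|a _]; last exact: r0.
(* The default of the minimum is the first ratio, or [0] without blocks. *)
by case: (enum 'I_k) => //= a _; apply: r0.
Qed.

Lemma nmin_le k (n : 'I_k -> nat) a : (nmin n <= n a)%N.
Proof.
by have := bigmin_le (head 0%N [seq n a | a <- enum 'I_k]) a n; rewrite minEnat leEnat.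
Qed.

Theorem mainTheorem13 (R : realFieldType) (m k : nat)
  (f : {set 'I_m} -> R) (part : 'I_m -> 'I_k) (n : 'I_k -> nat)
  (Sstar : {set 'I_m})
  (choose : 'I_m -> {set 'I_m} -> ('I_m -> R) -> 'I_m) :
  (forall S, 0 <= f S) -> submodular f ->
  (0 < k)%N -> (forall a : 'I_k, exists t, part t = a) ->
  (forall a, 0 < n a)%N ->
  feasible part n Sstar -> (forall T, feasible part n T -> f T <= f Sstar) ->
  valid_choice choose ->
  (* (1) small budget case *)
  ((nmin n <= 10)%N ->
     let p := p_small R in
     let d := fun a => d_small R (n a) in
     let r := fun a => (1 - p) / QQ p (d a) (n a) in
     let E := expected_value f part n p d choose in
     (forall a, small_lb R (n a) <= r a) /\
     minf r * f Sstar <= E /\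
     175%:R / 1000%:R * f Sstar <= E)
  /\
  (* (2) large budget case *)
  ((11 <= nmin n)%N ->
     let p := p_large R in
     let d := fun _ : 'I_k => d_large R in
     let r := fun a => (1 - p) / QQ p (d a) (n a) in
     let E := expected_value f part n p d choose in
     (forall a, 1921%:R / 10000%:R * (1 - 7676%:R / 10000%:R / (n a)%:R) <= r a) /\
     minf r * f Sstar <= E /\
     1921%:R / 10000%:R * (1 - 7676%:R / 10000%:R / (nmin n)%:R) * f Sstar <= E /\
     175%:R / 1000%:R * f Sstar <= E).
Proof.
move=> f_ge0 f_sub k_gt0 _ n_gt0 Sstar_feas _ choose_valid; split.
  move=> _ p d r E.
  have p_gt0 : 0 < p by rewrite /p /p_small; lra.
  have p_le1 : p <= 1 by rewrite /p /p_small; lra.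
  have d_gt0 a : 0 < d a by have /andP[] := d_small_bounds R (n_gt0 a).
  have pd_le1 a : p * d a <= 1.
    by have /andP[_] := d_small_bounds R (n_gt0 a); rewrite /p /p_small /d; lra.
  have r_lb a : small_lb R (n a) <= r a by apply: ratio_small.
  have r175 a : 175%:R / 1000%:R <= r a by apply: le_trans (r_lb a); apply: small_lb_ge.
  have bound rho := @expected_value_ge_ratio R m k f part n p d choose f_ge0 f_sub
    n_gt0 choose_valid p_gt0 p_le1 d_gt0 pd_le1 Sstar Sstar_feas rho k_gt0.
  split=> //; split; apply: bound => //.
  - by apply: minf_ge0 => a; apply: le_trans (r175 a); lra.
  - exact: minf_le.
  - by lra.
move=> n11 p d r E.
have d_gt0 a : 0 < d a by rewrite /d /d_large; lra.
have pE : p = 10000%:R / 29532%:R by rewrite /p /p_large /d_large; field.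
have p_gt0 : 0 < p by rewrite pE; lra.
have p_le1 : p <= 1 by rewrite pE; lra.
have pd_le1 a : p * d a <= 1 by rewrite pE /d /d_large; lra.
have na11 a : (11 <= n a)%N by apply: leq_trans n11 (nmin_le n a).
have r_lb a : 1921%:R / 10000%:R * (1 - 7676%:R / 10000%:R / (n a)%:R) <= r a.
  exact: ratio_large.
have /andP[x0 x1] := inv_n_bounds R n11.
(* The bound increases with the budget, so the smallest budget gives the least one. *)
have r_nmin a : 1921%:R / 10000%:R * (1 - 7676%:R / 10000%:R / (nmin n)%:R) <= r a.
  apply: le_trans (r_lb a).
  have : (n a)%:R^-1 <= (nmin n)%:R^-1 :> R.
    by rewrite lef_pV2 ?ler_nat ?nmin_le // posrE ltr0n (@leq_trans 11).
  by lra.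
have r175 a : 175%:R / 1000%:R <= r a by apply: le_trans (r_nmin a); lra.
have bound rho := @expected_value_ge_ratio R m k f part n p d choose f_ge0 f_sub
  n_gt0 choose_valid p_gt0 p_le1 d_gt0 pd_le1 Sstar Sstar_feas rho k_gt0.
split=> //; do !split; apply: bound => //.
- by apply: minf_ge0 => a; apply: le_trans (r175 a); lra.
- exact: minf_le.
- by lra.
- by lra.
Qed.
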